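(* Let $d\in\mathbb{N}$, $m>0$, $\alpha>0$, $1\le p'\le\infty$, and $g\in L^{p'}(\mathbb{R}^d)$. Here $c_1,c_2,b_1,b_2$ denote strictly positive finite constants, which may depend on $g$, and an inequality followed by ''$t\to\infty$'' means that it holds for all sufficiently large $t$. 1. Let $1\le p'<\infty$. (i) If there is $c_2$ such that $\psi_{p'}[g](t)\le c_2t^{-\alpha}$, $t\to\infty$, then there is $b_2$ such that, as $t\to\infty$, $$\psi_{p',m}[g](t)\le b_2\cdot\begin{cases}t^{-\alpha},&0<\alpha<m,\\ t^{-\alpha}(\log t)^{1/p'},&\alpha=m,\\ t^{-m},&\alpha>m.\end{cases}$$ (ii) If there are $c_1,c_2$ such that $c_1t^{-\alpha}\le\psi_{p',m}[g](t)\le c_2t^{-\alpha}$, $t\to\infty$, then there is $b_1$ such that, as $t\to\infty$, $$\psi_{p'}[g](t)\ge b_1\cdot\begin{cases}t^{-\alpha},&0<\alpha<m,\\ 0,&\alpha\ge m.\end{cases}$$ 2. Let $p'=\infty$. (i) If there is $c_2$ such that $\psi_\infty[g](t)\le c_2t^{-\alpha}$, $t\to\infty$, then there is $b_2$ such that, as $t\to\infty$, $$\psi_{\infty,m}[g](t)\le b_2\cdot\begin{cases}t^{-\alpha},&0<\alpha<m,\\ t^{-m},&\alpha\ge m.\end{cases}$$ (ii) If there are $c_1,c_2$ such that $c_1t^{-\alpha}\le\psi_{\infty,m}[g](t)\le c_2t^{-\alpha}$, $t\to\infty$, then there is $b_1$ such that, as $t\to\infty$, $$\psi_\infty[g](t)\ge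 b_1\cdot\begin{cases}t^{-\alpha},&0<\alpha<m,\\ 0,&\alpha\ge m.\end{cases}$$
   Context: For $g\in L^{p'}(\mathbb{R}^d)$ and $t>0$, the (true) tail is $$\psi_{p'}[g](t)=\Big(\int_{|\xi|\ge t}|g(\xi)|^{p'}\,d\xi\Big)^{1/p'}\ (1\le p'<\infty),\qquad \psi_\infty[g](t)=\sup_{|\xi|\ge t}|g(\xi)|,$$ and the modified tail is $$\psi_{p',m}[g](t)=\Big(\int_{\mathbb{R}^d}\min\big(1,(|\xi|/t)^{mp'}\big)|g(\xi)|^{p'}\,d\xi\Big)^{1/p'}\ (1\le p'<\infty),$$ $$\psi_{\infty,m}[g](t)=\sup_{\xi\in\mathbb{R}^d}\Big(\min\big(1,(|\xi|/t)^m\big)|g(\xi)|\Big).$$ Suprema are essential suprema. *)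

(* Defs.v *)
From HB Require Import structures.
From mathcomp Require Import all_boot all_order all_algebra.
From mathcomp Require Import all_classical all_reals all_analysis.
From mathcomp Require Import ess_sup_inf.
From mathcomp Require Import complex.

Set Implicit Arguments.
Unset Strict Implicit.
Unset Printing Implicit Defensive.

Import Order.TTheory GRing.Theory Num.Theory.
Import numFieldNormedType.Exports.

Local Open Scope classical_set_scope.
Local Open Scope ring_scope.
Local Open Scope ereal_scope.

Section lebesgue_tuple.
Variable R : realType.

Definition cons_pair n (x : R * n.-tuple R) : n.+1.-tuple R := cons_tuple x.1 x.2.

Definition uncons_pair n (x : n.+1.-tuple R) : R * n.-tuple R :=
  (thead x, behead_tuple x).

Lemma cons_pairK n : cancel (@cons_pair n) (@uncons_pair n).
Proof.
by case=> a x; rewrite /uncons_pair /cons_pair/= theadE; congr pair; exact: val_inj.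
Qed.

Lemma measurable_cons_pair n : measurable_fun setT (@cons_pair n).
Proof. exact: measurable_cons. Qed.

Lemma measurable_uncons_pair n : measurable_fun setT (@uncons_pair n).
Proof.
apply: measurable_fun_pair; first exact: measurable_tnth.
exact: measurable_behead.
Qed.

(* The d-dimensional Lebesgue measure, on the Borel sets of [d.-tuple R]: the
   unit mass on the one-point space for d = 0, and the image under [cons_pair]
   of the product of [lebesgue_measure] with the measure in dimension d for
   d + 1. See [lebesgue_tuple_box]. *)
Fixpoint lebesgue_tuple d : set (d.-tuple R) -> \bar R :=
  if d is n.+1 then pushforward (lebesgue_measure \x @lebesgue_tuple n) (@cons_pair n)
  else \d_[tuple].

Section lebesgue_cons.
Variables (n : nat) (mu : {sigma_finite_measure set (n.-tuple R) -> \bar R}).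

Let nu : set (n.+1.-tuple R) -> \bar R := pushforward (lebesgue_measure \x mu) (@cons_pair n).

Let mcons_pair A : measurable A -> measurable (@cons_pair n @^-1` A).
Proof. by move=> mA; rewrite -[X in measurable X]setTI; exact: measurable_cons_pair. Qed.

Let nu0 : nu set0 = 0.
Proof. by rewrite /nu /pushforward preimage_set0 measure0. Qed.

Let nu_ge0 A : 0 <= nu A.
Proof. exact: (measure_ge0 (lebesgue_measure \x mu)). Qed.

Let nu_sigma_additive : semi_sigma_additive nu.
Proof.
move=> F mF tF mUF; rewrite /nu /pushforward preimage_bigcup.
apply: measure_semi_sigma_additive.
- by move=> k; exact: mcons_pair.
- by apply/trivIsetP => i j _ _ ij; rewrite -preimage_setI;
    move/trivIsetP : tF => /(_ _ _ I I ij) ->; rewrite preimage_set0.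
- by rewrite -preimage_bigcup; exact: mcons_pair.
Qed.

HB.instance Definition _ := isMeasure.Build _ _ _ nu nu0 nu_ge0 nu_sigma_additive.

Let nu_sigma_finite : sigma_finite setT nu.
Proof.
have /sigma_finiteP[F [TF ndF Foo]] := sigma_finiteT (@lebesgue_measure R).
have /sigma_finiteP[G [TG ndG Goo]] := sigma_finiteT mu.
exists (fun k => @uncons_pair n @^-1` (F k `*` G k)).
  rewrite -preimage_bigcup (_ : \bigcup_k _ = setT) ?preimage_setT//.
  apply/seteqP; split => // -[x y] _.
  have [i _ Fx] : (\bigcup_k F k) x by rewrite -TF.
  have [j _ Gy] : (\bigcup_k G k) y by rewrite -TG.
  exists (maxn i j) => //; split.
    exact: (subsetPset (F i) (F (maxn i j)) (ndF _ _ (leq_maxl i j))).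
  exact: (subsetPset (G j) (G (maxn i j)) (ndG _ _ (leq_maxr i j))).
move=> k; have [mF Fk] := Foo k; have [mG Gk] := Goo k; split.
  rewrite -[X in measurable X]setTI; apply: measurable_uncons_pair => //.
  exact: measurableX.
rewrite /nu /pushforward -comp_preimage (_ : _ \o _ = idfun); last first.
  by apply/funext => x; exact: cons_pairK.
by rewrite preimage_id product_measure1E// lte_mul_pinfty// ge0_fin_numE.
Qed.

HB.instance Definition _ := Measure_isSigmaFinite.Build _ _ _ nu nu_sigma_finite.

Definition lebesgue_cons : {sigma_finite_measure set (n.+1.-tuple R) -> \bar R} := nu.

End lebesgue_cons.

Lemma lebesgue_tuple_measure d : exists mu : {sigma_finite_measure set (d.-tuple R) -> \bar R},
  @lebesgue_tuple d = mu.
Proof.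
elim: d => [|n [mu muE]]; last by exists (lebesgue_cons mu); rewrite /= muE.
by exists (\d_([tuple] : 0.-tuple R) : {sigma_finite_measure set _ -> \bar R}).
Qed.

Section instances.
Variable d : nat.

Let leb0 : @lebesgue_tuple d set0 = 0.
Proof. by have [mu ->] := lebesgue_tuple_measure d; exact: measure0. Qed.

Let leb_ge0 A : 0 <= @lebesgue_tuple d A.
Proof. by have [mu ->] := lebesgue_tuple_measure d; exact: measure_ge0. Qed.

Let leb_sigma_additive : semi_sigma_additive (@lebesgue_tuple d).
Proof. by have [mu ->] := lebesgue_tuple_measure d; exact: measure_semi_sigma_additive. Qed.

HB.instance Definition _ :=
  isMeasure.Build _ _ _ (@lebesgue_tuple d) leb0 leb_ge0 leb_sigma_additive.

Let leb_sigma_finite : sigma_finite setT (@lebesgue_tuple d).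
Proof. by have [mu ->] := lebesgue_tuple_measure d; exact: sigma_finiteT. Qed.

HB.instance Definition _ :=
  Measure_isSigmaFinite.Build _ _ _ (@lebesgue_tuple d) leb_sigma_finite.

End instances.

Lemma lebesgue_tuple_box d (a b : 'I_d -> R) : (forall i, (a i <= b i)%R) ->
  lebesgue_tuple [set x : d.-tuple R | forall i, tnth x i \in `[a i, b i]] =
  (\prod_(i < d) (b i - a i))%:E.
Proof.
elim: d a b => [|n IH] a b ab.
  by rewrite big_ord0 /= diracE mem_set//= => -[].
pose A' := [set x : n.-tuple R | forall i, tnth x i \in `[a (lift ord0 i), b (lift ord0 i)]].
have mA' : measurable A'.
  rewrite (_ : A' = \bigcap_i (fun x : n.-tuple R => tnth x i) @^-1` `[a (lift ord0 i), b (lift ord0 i)]).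
    apply: fin_bigcap_measurable => // i _; rewrite -[X in measurable X]setTI.
    exact: measurable_tnth.
  by apply/seteqP; split => x /= Ax i //=; exact: Ax.
have [mu muE] := lebesgue_tuple_measure n.
rewrite [LHS]/= /pushforward (_ : _ @^-1` _ = `[a ord0, b ord0] `*` A'); last first.
  apply/seteqP; split => -[x y] /=.
    move=> Axy; split; first exact: (Axy ord0).
    by move=> i; have := Axy (lift ord0 i); rewrite tnthS.
  move=> [x0 Ay] i; case: (unliftP ord0 i) => [j ->|->//].
  by rewrite tnthS; exact: Ay.
rewrite muE product_measure1E// -muE IH// big_ord_recl EFinM; congr (_ * _).
have leb_itv : lebesgue_measure `[a ord0, b ord0]%classic = (b ord0 - a ord0)%:E.
  rewrite lebesgue_measure_itv/= lte_fin.
  by case: ltgtP (ab ord0) => // -> _; rewrite subrr.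
exact: leb_itv.
Qed.

End lebesgue_tuple.
Arguments lebesgue_tuple {R} d _.

Section tails.
Context {R : realType} {d : nat}.
Implicit Types (x : d.-tuple R) (g : d.-tuple R -> R[i]) (p : \bar R) (m t : R).

Definition euclidean_norm x : R := Num.sqrt (\sum_(i < d) tnth x i ^+ 2)%R.

(* The modulus as an element of [R]; on [R[i]], [`|z|] is an element of [R[i]]. *)
Definition modulus (z : R[i]) : R := ComplexField.Normc.normc z.

(* Elements of L^p are represented by Borel functions: every class modulo
   equality almost everywhere contains one. *)
Definition in_Lp p g : Prop :=
  [/\ measurable_fun setT (fun x => complex.Re (g x)),
      measurable_fun setT (fun x => complex.Im (g x)) &
      finite_norm (lebesgue_tuple d) p (fun x => modulus (g x))].

(* For p = +oo, extending by 0 outside of the domain does not change the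
   essential supremum of the nonnegative function |g| over |x| >= t, a set of
   positive measure as soon as d > 0. The value at -oo is irrelevant. *)
Definition tail p g t : \bar R :=
  match p with
  | q%:E => (\int[lebesgue_tuple d]_(x in [set x | (t <= euclidean_norm x)%R])
              (modulus (g x) `^ q)%:E) `^ q^-1
  | +oo => ess_sup (lebesgue_tuple d)
             ((fun x => (modulus (g x))%:E) \_ [set x | (t <= euclidean_norm x)%R])
  | -oo => 0
  end.

Definition modified_tail p m g t : \bar R :=
  match p with
  | q%:E => (\int[lebesgue_tuple d]_x
              (Num.min 1 ((euclidean_norm x / t) `^ (m * q)) *
               modulus (g x) `^ q)%:E) `^ q^-1
  | +oo => ess_sup (lebesgue_tuple d)
             (fun x => (Num.min 1 ((euclidean_norm x / t) `^ m) * modulus (g x))%:E)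
  | -oo => 0
  end.

End tails.

(* Main.v *)
Require Import Defs.
From mathcomp Require Import all_boot all_order all_algebra.
From mathcomp Require Import all_classical all_reals all_analysis.
From mathcomp Require Import complex.
From mathcomp Require Import measurable_realfun ess_sup_inf ring lra.

(** Both tails are governed by one scaling inequality. For l >= 1 and a > 0 the
    truncated weight w(r) = min(1, r^a) satisfies
      w(r / (l t)) <= max (l^-a w(r / t), 1_(t <= r)),
    since the dilation costs a factor l^-a inside the ball of radius t, while
    w <= 1 outside of it. Write M for the modified tail and F for the true one.
    Taking essential suprema gives, for p' = oo and a = m,
      M(l t) <= max (l^-m M(t), F(t));
    integrating against |g|^q, and bounding the maximum by the sum, gives for
    p' = q < oo the inequality
      M(l t) <= l^-a M(t) + F(t),    a = m q,
    where M and F now denote the q-th powers of the tails. These are the lemmas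
    [modified_tail_sup_dilation] and [modified_tail_pow_dilation]. Everything
    else is about two functions of t related by such a recursion.

    Upper bounds use l = 2. If F(t) <= C t^-b for large t, then N(t) = t^a M(t)
    satisfies N(2t) <= N(t) + 2^a C t^(a-b), so N is at most a constant plus a
    multiple of the geometric sum of the 2^(j(a-b)) over the dyadic scales below
    t. That sum is of order t^(a-b), log t or 1 according to the sign of a - b,
    which yields the three regimes ([decay_of_additive_recursion]). With a
    maximum in place of the sum nothing accumulates, and the logarithm
    disappears ([decay_of_max_recursion]).

    Lower bounds use a large fixed l. If c1 t^-b <= M(t) <= c2 t^-b with b < a,
    then F(t) >= M(l t) - l^-a M(t) >= (c1 l^-b - c2 l^-a) t^-b, and the
    coefficient is positive once l^(a-b) > c2 / c1
    ([lower_bound_of_recursion]). *)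

Import Order.TTheory GRing.Theory Num.Theory.
Import numFieldNormedType.Exports.

Local Open Scope classical_set_scope.
Local Open Scope ring_scope.

(** * Two functions related by a recursion over scales *)

Section recursions.
Context {R : realType}.
Set Implicit Arguments.
Unset Strict Implicit.

Lemma eventually_ge2 (P : R -> Prop) :
  (\forall t \near +oo, P t) ->
  exists2 t0 : R, 2 <= t0 & forall t, t0 <= t -> P t.
Proof.
move=> [A [_ AP]]; exists (Num.max 2 (A + 1)); first by rewrite le_max lexx.
move=> t; rewrite ge_max => /andP[_ At]; apply: AP.
by rewrite (lt_le_trans _ At)// ltrDl.
Qed.

Lemma near_pinfty_ge (P : R -> Prop) (t0 : R) :
  (forall t, t0 <= t -> P t) -> \forall t \near +oo, P t.
Proof.
by move=> t0P; apply: filterS (nbhs_pinfty_ge (num_real t0)).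
Qed.

Lemma dyadic_ind (P : R -> Prop) (t0 : R) : 0 < t0 ->
  (forall t, t0 <= t -> t <= 2 * t0 -> P t) ->
  (forall t, t0 <= t -> P t -> P (2 * t)) ->
  forall t, t0 <= t -> P t.
Proof.
move=> t0_gt0 Pbase Pstep.
have Pn n t : t0 <= t -> t <= 2 ^+ n * t0 -> P t.
  elim: n t => [|n IH] t t0t.
    by rewrite expr0 mul1r => tt0; apply: Pbase => //; lra.
  have [t2t0 _|t2t0] := leP t (2 * t0); first exact: Pbase.
  rewrite exprS -mulrA => tn.
  have -> : t = 2 * (t / 2) by lra.
  by apply: Pstep; [lra|apply: IH; lra].
move=> t t0t; apply: (Pn (Num.bound (t / t0)) t t0t).
by rewrite -ler_pdivrMr// ltW// Num.Theory.upper_nthrootP.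
Qed.

(** Interpolation, to real t, of the geometric sum of (2^j)^s over 0 <= j < n at
    t = 2^n: what a recursion with increment t^s accumulates between 1 and t. At
    s = 0 the sum is n = log_2 t. *)
Definition dyadic_sum (s t : R) : R :=
  if s == 0 then ln t / ln 2 else (t `^ s - 1) / (2 `^ s - 1).

Lemma powR2_gt1 (s : R) : 0 < s -> 1 < 2 `^ s.
Proof.
move=> s_gt0; have := @gt0_ltr_powR R s s_gt0 1 2.
by rewrite !nnegrE powR1; apply; lra.
Qed.

Lemma powR2_lt1 (s : R) : s < 0 -> 2 `^ s < 1.
Proof.
move=> s_lt0; rewrite -[s]opprK powRN invf_lt1 ?powR_gt0//.
by apply: powR2_gt1; lra.
Qed.

Lemma ln2_gt0 : 0 < ln (2 : R).
Proof. by rewrite ln_gt0// ltr1n. Qed.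

Lemma dyadic_sum_double (s t : R) : 0 < t ->
  dyadic_sum s (2 * t) = dyadic_sum s t + t `^ s.
Proof.
move=> t_gt0; rewrite /dyadic_sum; have [->|s_neq0] := eqVneq s 0.
  rewrite lnM ?posrE// powRr0 mulrDl divff ?gt_eqF ?ln2_gt0//.
  by rewrite addrC.
have ns : 2 `^ s - 1 != 0 :> R.
  have [s_lt0|s_gt0|s0] := ltgtP s 0; last by rewrite s0 eqxx in s_neq0.
    by have := powR2_lt1 s_lt0; lra.
  by have := powR2_gt1 s_gt0; lra.
rewrite powRM ?(ltW t_gt0)//; field.
exact: ns.
Qed.

Lemma dyadic_sum_ge0 (s t : R) : 1 <= t -> 0 <= dyadic_sum s t.
Proof.
move=> t_ge1; rewrite /dyadic_sum; have [s0|s_neq0] := eqVneq s 0.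
  by rewrite divr_ge0 ?ln_ge0// ?ler1n.
have [s_lt0|s_gt0|s0] := ltgtP s 0; last by rewrite s0 eqxx in s_neq0.
  rewrite -mulrNN -invrN mulr_ge0// ?invr_ge0.
    have := ler_powR t_ge1 (ltW s_lt0); rewrite powRr0; lra.
  have := powR2_lt1 s_lt0; lra.
rewrite divr_ge0//.
  have := ler_powR t_ge1 (ltW s_gt0); rewrite powRr0; lra.
have := powR2_gt1 s_gt0; lra.
Qed.

(** The sign of s decides which end of the geometric sum dominates: the last term
    for s > 0, the first one for s < 0, and none for s = 0, whence the logarithm.
    Starting at t = 2 lets the constant c be absorbed, ln t being away from 0. *)
Lemma dyadic_sum_rate (s c E : R) : 0 < c -> 0 < E ->
  exists2 B : R, 0 < B & forall t, 2 <= t ->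
    c + E * dyadic_sum s t <=
    B * (if 0 < s then t `^ s else if s == 0 then ln t else 1).
Proof.
move=> c_gt0 E_gt0.
have [s_lt0|s_gt0|s0] := ltgtP s 0.
- have p1 : 0 < 1 - 2 `^ s by have := powR2_lt1 s_lt0; lra.
  exists (c + E / (1 - 2 `^ s)); first by rewrite addr_gt0// divr_gt0.
  move=> t t2; rewrite mulr1 lerD2l ler_pM2l//.
  rewrite /dyadic_sum lt_eqF// -mulrNN -invrN !opprB.
  rewrite ler_pdivrMr// mulVf ?gt_eqF//.
  by have := powR_ge0 t s; lra.
- have p1 : 0 < 2 `^ s - 1 by have := powR2_gt1 s_gt0; lra.
  exists (c + E / (2 `^ s - 1)); first by rewrite addr_gt0// divr_gt0.
  move=> t t2.
  have ts1 : 1 <= t `^ s.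
    by rewrite -(powRr0 t) ler_powR ?ltW//; lra.
  rewrite mulrDl; apply: lerD; first by rewrite ler_peMr// ltW.
  rewrite -mulrA ler_pM2l// /dyadic_sum gt_eqF// mulrC ler_pM2l ?invr_gt0//.
  lra.
- exists ((c + E) / ln 2); first by rewrite divr_gt0 ?addr_gt0 ?ln2_gt0.
  move=> t t2; rewrite /dyadic_sum s0 eqxx.
  have lnt : 1 <= ln t / ln 2.
    by rewrite ler_pdivlMr ?ln2_gt0// mul1r ler_ln ?posrE//; lra.
  have -> : (c + E) / ln 2 * ln t = c * (ln t / ln 2) + E * (ln t / ln 2).
    by field; rewrite gt_eqF ?ln2_gt0.
  by rewrite lerD2r ler_peMr// ltW.
Qed.

(** The function (c + E S(t)) t^-a, with S the dyadic sum of exponent a - b, turns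
    the recursion into an equality when E = 2^a C, and it dominates the bounded
    function M on the first block [t0, 2 t0] for a suitable c. *)
Lemma decay_of_additive_recursion (M F : R -> \bar R)
    (a b C K : R) : 0 <= a -> 0 < C -> 0 < K ->
  (forall t : R, 0 < t -> (M t <= K%:E)%E) ->
  (forall t : R, 0 < t -> (M (2 * t)%R <= (2 `^ (- a))%:E * M t + F t)%E) ->
  (\forall t \near +oo, (F t <= (C * t `^ (- b))%:E)%E) ->
  exists2 B : R, 0 < B & \forall t \near +oo,
    (M t <= (B * (if (b < a)%R then t `^ (- b)
                  else if b == a then t `^ (- a) * ln t
                  else t `^ (- a)))%:E)%E.
Proof.
move=> a_ge0 C_gt0 K_gt0 MK Mrec /eventually_ge2[t0 t0_ge2 Ft].
have t0_gt0 : 0 < t0 by lra.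
pose c := K * (2 * t0) `^ a; pose E := 2 `^ a * C.
have c_gt0 : 0 < c by rewrite mulr_gt0// powR_gt0//; lra.
have E_gt0 : 0 < E by rewrite mulr_gt0// powR_gt0.
have Mle t : t0 <= t ->
    (M t <= ((c + E * dyadic_sum (a - b) t) * t `^ (- a))%:E)%E.
  (* On the first block only M <= K is known; c is what makes c t^-a >= K there. *)
  apply: (dyadic_ind _ (P := fun t => (M t <= ((c + E * dyadic_sum (a - b) t) *
    t `^ (- a))%:E)%E) (t0 := t0)) => // {}t t0t.
    move=> tt0; have t_gt0 : 0 < t by lra.
    apply: le_trans (MK t t_gt0) _; rewrite lee_fin powRN.
    rewrite ler_pdivlMr ?powR_gt0//.
    apply: (@le_trans _ _ c).
      rewrite ler_pM2l// ge0_ler_powR// nnegrE; lra.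
    by rewrite lerDl mulr_ge0 ?(ltW E_gt0)// dyadic_sum_ge0//; lra.
  move=> Mt; have t_gt0 : 0 < t by lra.
  apply: le_trans (Mrec t t_gt0) _.
  apply: (@le_trans _ _ ((2 `^ (- a))%:E *
      ((c + E * dyadic_sum (a - b) t) * t `^ (- a))%:E + (C * t `^ (- b))%:E)%E).
    by rewrite leeD ?Ft// lee_pmul2l ?lte_fin ?powR_gt0.
  rewrite -EFinM -EFinD lee_fin dyadic_sum_double// powRM ?(ltW t_gt0)//.
  rewrite powRB ?(gt_eqF t_gt0) ?implybT// !powRN /E.
  have := powR_gt0 a t_gt0; have := powR_gt0 b t_gt0.
  have := @powR_gt0 R 2 a ltac:(lra).
  move: (t `^ a) (t `^ b) (2 `^ a) (dyadic_sum _ _) => x y z w z0 y0 x0.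
  by rewrite le_eqVlt; apply/predU1P; left; field; rewrite !gt_eqF.
have [B B_gt0 rate] := dyadic_sum_rate (a - b) c_gt0 E_gt0.
exists B => //; apply: (near_pinfty_ge (t0 := t0)) => t t0t.
have t_gt0 : 0 < t by lra.
apply: le_trans (Mle t t0t) _; rewrite lee_fin.
apply: le_trans (ler_wpM2r (powR_ge0 t (- a)) (rate t _)) _; first by lra.
rewrite -mulrA ler_pM2l// subr_gt0 subr_eq0 eq_sym.
case: ifP => _; last by case: ifP; rewrite ?mul1r// mulrC.
by rewrite -powRD ?(gt_eqF t_gt0) ?implybT// addrAC subrr add0r.
Qed.

(** As b <= a, each branch of the maximum preserves a bound B t^-b when t doubles:
    the first since 2^-a <= 2^-b, the second as soon as B >= 2^b C. So the case
    a = b costs no logarithm here. *)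
Lemma decay_of_max_recursion (M F : R -> \bar R)
    (a b C K : R) : 0 <= b -> b <= a -> 0 < C -> 0 < K ->
  (forall t : R, 0 < t -> (M t <= K%:E)%E) ->
  (forall t : R, 0 < t ->
    (M (2 * t)%R <= Order.max ((2 `^ (- a))%:E * M t) (F t))%E) ->
  (\forall t \near +oo, (F t <= (C * t `^ (- b))%:E)%E) ->
  exists2 B : R, 0 < B &
    \forall t \near +oo, (M t <= (B * t `^ (- b))%:E)%E.
Proof.
move=> b_ge0 ba C_gt0 K_gt0 MK Mrec /eventually_ge2[t0 t0_ge2 Ft].
have t0_gt0 : 0 < t0 by lra.
have c_gt0 : 0 < K * (2 * t0) `^ b by rewrite mulr_gt0// powR_gt0//; lra.
have E_gt0 : 0 < 2 `^ b * C by rewrite mulr_gt0// powR_gt0.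
exists (K * (2 * t0) `^ b + 2 `^ b * C); first exact: addr_gt0.
apply: (near_pinfty_ge (t0 := t0)).
apply: dyadic_ind => // t t0t.
  move=> tt0; have t_gt0 : 0 < t by lra.
  apply: le_trans (MK t t_gt0) _; rewrite lee_fin powRN.
  rewrite ler_pdivlMr ?powR_gt0//.
  apply: (@le_trans _ _ (K * (2 * t0) `^ b)).
    rewrite ler_pM2l// ge0_ler_powR// nnegrE; lra.
  by rewrite lerDl ltW.
move=> Mt; have t_gt0 : 0 < t by lra.
apply: le_trans (Mrec t t_gt0) _; rewrite (@powRM _ 2 t) ?(ltW t_gt0)// ge_max.
apply/andP; split.
  apply: (@le_trans _ _ ((2 `^ (- a))%:E *
      ((K * (2 * t0) `^ b + 2 `^ b * C) * t `^ (- b))%:E)%E).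
    by rewrite lee_pmul2l ?lte_fin ?powR_gt0.
  rewrite -EFinM lee_fin mulrCA ler_pM2l ?addr_gt0// ler_pM2r ?powR_gt0//.
  by rewrite ler_powR ?lerN2//; lra.
apply: le_trans (Ft t t0t) _; rewrite lee_fin mulrA ler_pM2r ?powR_gt0//.
rewrite mulrDl [X in _ + X]mulrAC -powRD ?pnatr_eq0 ?implybT// subrr powRr0 mul1r.
by rewrite lerDr mulr_ge0 ?powR_ge0// ltW.
Qed.

(** The dilated term l^-a M(t) is of order l^-a t^-b, negligible with respect to
    M(l t), of order l^-b t^-b, when l is large: so F(t) must supply the rest. *)
Lemma lower_bound_of_recursion (M F : R -> \bar R) (a b c1 c2 : R) :
  b < a -> 0 < c1 -> 0 < c2 ->
  (forall l t : R, 1 <= l -> 0 < t ->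
    (M (l * t)%R <= (l `^ (- a))%:E * M t + F t)%E) ->
  (\forall t \near +oo, ((c1 * t `^ (- b))%:E <= M t)%E /\
                        (M t <= (c2 * t `^ (- b))%:E)%E) ->
  exists2 b1 : R, 0 < b1 &
    \forall t \near +oo, ((b1 * t `^ (- b))%:E <= F t)%E.
Proof.
move=> ba c1_gt0 c2_gt0 Mrec /eventually_ge2[t0 t0_ge2 Mt].
(* l^(a - b) = k, chosen so that c2 / k <= c1 / 2. *)
pose k := 1 + 2 * c2 / c1; pose l := k `^ (a - b)^-1.
have k_gt1 : 1 < k by rewrite ltrDl divr_gt0// mulr_gt0.
have k_gt0 : 0 < k by lra.
have l_ge1 : 1 <= l.
  by rewrite /l -(powRr0 k) ler_powR ?invr_ge0//; lra.
have l_gt0 : 0 < l by lra.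
have lab : l `^ (- a) = l `^ (- b) / k.
  have -> : - a = - b - (a - b) by lra.
  rewrite powRB ?(gt_eqF k_gt0) ?(gt_eqF l_gt0) ?implybT//; congr (_ / _).
  by rewrite -powRrM mulVf ?powRr1 ?ltW// subr_eq0 gt_eqF.
exists (l `^ (- b) * (c1 / 2)); first by rewrite mulr_gt0 ?powR_gt0//; lra.
apply: (near_pinfty_ge (t0 := t0)) => t t0t.
have t_gt0 : 0 < t by lra.
have [_ Mup] := Mt t t0t.
have lt_ge : t0 <= l * t by rewrite (le_trans t0t)// ler_peMl// ltW.
have [Mlow _] := Mt _ lt_ge.
rewrite powRM ?(ltW t_gt0) ?(ltW l_gt0)// in Mlow.
have {}Mrec : ((c1 * (l `^ (- b) * t `^ (- b)))%:E <=
    (l `^ (- a) * (c2 * t `^ (- b)))%:E + F t)%E.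
  apply: le_trans Mlow _; apply: le_trans (Mrec l t l_ge1 t_gt0) _.
  by rewrite leeD2r// EFinM lee_pmul2l ?lte_fin ?powR_gt0.
rewrite -leeBlDl// in Mrec; apply: le_trans _ Mrec.
rewrite -EFinB lee_fin lab.
have lb := powR_gt0 (- b) l_gt0; have tb := powR_gt0 (- b) t_gt0.
have -> : c1 * (l `^ (- b) * t `^ (- b)) -
    l `^ (- b) / k * (c2 * t `^ (- b)) =
    l `^ (- b) * (c1 - c2 / k) * t `^ (- b) by ring.
rewrite ler_pM2r// ler_pM2l// -subr_ge0.
suff : c2 / k <= c1 / 2 by lra.
rewrite ler_pdivrMr// /k mulrDr mulr1.
have -> : c1 / 2 * (2 * c2 / c1) = c2 by field; rewrite gt_eqF.
lra.
Qed.

End recursions.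

(** * Dilation of the truncated weight *)

Section truncation.
Set Implicit Arguments.
Unset Strict Implicit.

Context {R : realType}.
Implicit Types a l r t : R.

Definition truncation a r : R := Num.min 1 (r `^ a).

Lemma truncation_ge0 a r : 0 <= truncation a r.
Proof. by rewrite le_min ler01 powR_ge0. Qed.

Lemma truncation_le1 a r : truncation a r <= 1.
Proof. by rewrite ge_min lexx. Qed.

(** The pointwise inequality behind both recursions. For r < t both truncations
    are inactive and the weight is homogeneous of degree a; for r >= t it is at
    most 1. *)
Lemma truncation_dilation a l r t : 0 <= a -> 1 <= l -> 0 < t -> 0 <= r ->
  truncation a (r / (l * t)) <=
  Num.max (l `^ (- a) * truncation a (r / t)) (t <= r)%R%:R.
Proof.
move=> a_ge0 l_ge1 t_gt0 r_ge0; have l_gt0 : 0 < l by lra.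
rewrite le_max; have [tr|rt] := leP t r; first by rewrite truncation_le1 orbT.
apply/orP; left; rewrite /truncation ge_min; apply/orP; right.
rewrite powRN minr_pMr ?invr_ge0 ?powR_ge0// mulr1 le_min.
have lt_ge0 : 0 <= (l * t)^-1 by rewrite invr_ge0 mulr_ge0 ?ltW.
have -> : r / (l * t) = l^-1 * (r / t) by field; rewrite !gt_eqF.
have rt_ge0 : 0 <= r / t by rewrite divr_ge0 // ltW.
have -> : (l^-1 * (r / t)) `^ a = (l `^ a)^-1 * (r / t) `^ a.
  have li_ge0 : 0 <= l^-1 by rewrite invr_ge0 ltW.
  rewrite (powRM _ li_ge0 rt_ge0); congr (_ * _).
  by rewrite -(powR_inv1 (ltW l_gt0)) -powRrM mulN1r powRN.
rewrite lexx andbT ler_piMr ?invr_ge0 ?powR_ge0//.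
have <- : 1 `^ a = 1 :> R by rewrite powR1.
by rewrite ge0_ler_powR ?nnegrE// ler_pdivrMr// mul1r ltW.
Qed.

Lemma measurable_truncation a : measurable_fun setT (truncation a).
Proof.
apply: measurable_minr; first exact: measurable_cst.
exact: measurable_powR.
Qed.

End truncation.

Section dilation.
Set Implicit Arguments.
Unset Strict Implicit.

Context {disp : measure_display} {T : measurableType disp} {R : realType}.
Variable mu : {measure set T -> \bar R}.
Variables rho f : T -> R.
Hypotheses (rho_ge0 : forall x, 0 <= rho x) (f_ge0 : forall x, 0 <= f x).
Implicit Types a l t : R.

Lemma ess_sup_truncation_dilation a l t : 0 <= a -> 1 <= l -> 0 < t ->
  (ess_sup mu (fun x => (truncation a (rho x / (l * t)) * f x)%:E) <=
   Order.max
     ((l `^ (- a))%:E * ess_sup mu (fun x => (truncation a (rho x / t) * f x)%:E))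
     (ess_sup mu ((fun x => (f x)%:E) \_ [set x | (t <= rho x)%R])))%E.
Proof.
move=> a_ge0 l_ge1 t_gt0; apply/ess_supP.
have := ess_sup_ge mu (fun x => (truncation a (rho x / t) * f x)%:E).
have := ess_sup_ge mu ((fun x => (f x)%:E) \_ [set x | (t <= rho x)%R]).
apply: filterS2 => x Fx Mx.
have := truncation_dilation a_ge0 l_ge1 t_gt0 (rho_ge0 x).
rewrite !le_max => /orP[Wx|Wx]; apply/orP; [left|right].
  apply: le_trans (_ : ((l `^ (- a))%:E *
    (truncation a (rho x / t) * f x)%:E <= _)%E).
    by rewrite -EFinM lee_fin mulrA ler_wpM2r.
  by rewrite lee_wpmul2l ?lee_fin ?powR_ge0.
apply: le_trans Fx; rewrite patchE; case: ifPn => [xD|].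
  by rewrite lee_fin ler_piMl ?truncation_le1.
rewrite notin_setE/= => /negP/negPf xD; rewrite xD/= in Wx.
by rewrite lee_fin mulr_le0_ge0.
Qed.

Hypotheses (mrho : measurable_fun setT rho) (mf : measurable_fun setT f).

Lemma measurable_truncated a t :
  measurable_fun setT (fun x => truncation a (rho x / t)).
Proof.
apply: (measurableT_comp (measurable_truncation a)).
exact: measurable_funM.
Qed.

(** A maximum does not commute with the integral: this is where the sum replaces
    it, and where the logarithm of the critical case comes from. *)
Lemma integral_truncation_dilation a l t : 0 <= a -> 1 <= l -> 0 < t ->
  (\int[mu]_x (truncation a (rho x / (l * t)) * f x)%:E <=
   (l `^ (- a))%:E * \int[mu]_x (truncation a (rho x / t) * f x)%:E +
   \int[mu]_(x in [set x | (t <= rho x)%R]) (f x)%:E)%E.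
Proof.
move=> a_ge0 l_ge1 t_gt0.
have mD : measurable [set x | (t <= rho x)%R].
  rewrite -[X in measurable X]setTI.
  have := mrho measurableT (measurable_itv `[t, +oo[).
  by congr measurable; congr setI; apply/seteqP; split => x /=;
    rewrite in_itv/= andbT.
have mM s : measurable_fun setT (fun x => (truncation a (rho x / s) * f x)%:E).
  apply/measurable_EFinP; apply: measurable_funM => //.
  exact: measurable_truncated.
have M_ge0 s x : (0 <= (truncation a (rho x / s) * f x)%:E)%E.
  by rewrite lee_fin mulr_ge0 ?truncation_ge0.
have mF : measurable_fun setT ((fun x => (f x)%:E) \_ [set x | (t <= rho x)%R]).
  by apply/(measurable_restrictT _ _).1 => //; apply: measurable_funTS; apply/measurable_EFinP.
have F_ge0 x : (0 <= ((fun x => (f x)%:E) \_ [set x | (t <= rho x)%R]) x)%E.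
  by rewrite patchE; case: ifP; rewrite ?lee_fin.
rewrite [X in (_ <= _ + X)%E]integral_mkcond.
have l_ge0 : (0 <= (l `^ (- a))%:E)%E by rewrite lee_fin powR_ge0.
rewrite -ge0_integralZl// -ge0_integralD//; last 2 first.
- by move=> x _; rewrite mule_ge0.
- exact: measurable_funeM.
apply: ge0_le_integral => //.
  by apply: emeasurable_funD => //; exact: measurable_funeM.
move=> x _; have := truncation_dilation a_ge0 l_ge1 t_gt0 (rho_ge0 x).
rewrite patchE le_max => /orP[Wx|Wx].
  apply: le_trans (_ : ((l `^ (- a))%:E *
    (truncation a (rho x / t) * f x)%:E <= _)%E).
    by rewrite -EFinM lee_fin mulrA ler_wpM2r.
  by rewrite leeDl//; case: ifP; rewrite ?lee_fin.
apply: le_trans (_ : ((if x \in [set x | (t <= rho x)%R] then (f x)%:E else 0) <= _)%E).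
  case: ifPn => [xD|]; first by rewrite lee_fin ler_piMl ?truncation_le1.
  rewrite notin_setE/= => /negP/negPf xD; rewrite xD/= in Wx.
  by rewrite lee_fin mulr_le0_ge0.
by rewrite leeDr// mule_ge0.
Qed.

End dilation.

(** * Tails with respect to the Euclidean norm *)

Section exponents.
Context {R : realType}.
Implicit Types (x : \bar R) (c q : R).
Set Implicit Arguments.
Unset Strict Implicit.

Lemma poweR_invK x q : (0 <= x)%E -> q != 0 -> ((x `^ q^-1) `^ q = x)%E.
Proof. by move=> x_ge0 q_neq0; rewrite -poweRrM mulVf// poweRe1. Qed.

Lemma poweR_inv_le x c q : (0 <= x)%E -> 0 <= c -> 0 < q ->
  (x `^ q^-1 <= c%:E)%E = (x <= (c `^ q)%:E)%E.
Proof.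
move=> x_ge0 c_ge0 q_gt0; apply/idP/idP => xc.
  rewrite -(@poweR_invK x q)// ?gt_eqF// -poweR_EFin.
  by apply: gt0_ler_poweR => //; rewrite ?in_itv/= ?leey ?andbT ?poweR_ge0// ltW.
have -> : c%:E = ((c `^ q)%:E `^ q^-1)%E.
  by rewrite poweR_EFin -powRrM mulfV ?powRr1// gt_eqF.
apply: gt0_ler_poweR => //; rewrite ?in_itv/= ?leey ?andbT ?lee_fin ?powR_ge0//.
by rewrite invr_ge0 ltW.
Qed.

Lemma poweR_inv_ge x c q : (0 <= x)%E -> 0 <= c -> 0 < q ->
  (c%:E <= x `^ q^-1)%E = ((c `^ q)%:E <= x)%E.
Proof.
move=> x_ge0 c_ge0 q_gt0; apply/idP/idP => xc.
  rewrite -(@poweR_invK x q)// ?gt_eqF// -poweR_EFin.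
  by apply: gt0_ler_poweR => //; rewrite ?in_itv/= ?leey ?andbT ?poweR_ge0// ltW.
have -> : c%:E = ((c `^ q)%:E `^ q^-1)%E.
  by rewrite poweR_EFin -powRrM mulfV ?powRr1// gt_eqF.
apply: gt0_ler_poweR => //; rewrite ?in_itv/= ?leey ?andbT ?lee_fin ?powR_ge0//.
by rewrite invr_ge0 ltW.
Qed.

End exponents.

Section euclidean.
Context {R : realType} {d : nat}.
Set Implicit Arguments.
Unset Strict Implicit.

Lemma measurable_sqrt_ge0 disp (T : measurableType disp) (h : T -> R) :
  (forall x, 0 <= h x) -> measurable_fun setT h ->
  measurable_fun setT (fun x => Num.sqrt (h x)).
Proof.
move=> h_ge0 mh.
rewrite (_ : (fun x => _) = (fun x => h x `^ 2^-1)).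
  exact: (measurableT_comp (measurable_powR _)).
by apply/funext => x; rewrite powR12_sqrt.
Qed.

Lemma measurable_euclidean_norm :
  measurable_fun setT (@euclidean_norm R d).
Proof.
apply: measurable_sqrt_ge0.
  by move=> x; apply: sumr_ge0 => i _; exact: sqr_ge0.
by apply: measurable_sum => i; apply: measurable_funX; exact: measurable_tnth.
Qed.

Lemma euclidean_norm_ge0 (x : d.-tuple R) : 0 <= euclidean_norm x.
Proof. exact: sqrtr_ge0. Qed.

Lemma modulus_ge0 (z : R[i]) : 0 <= modulus z.
Proof. by case: z => a b; exact: sqrtr_ge0. Qed.

Lemma measurable_modulus (g : d.-tuple R -> R[i]) :
  measurable_fun setT (fun x => complex.Re (g x)) ->
  measurable_fun setT (fun x => complex.Im (g x)) ->
  measurable_fun setT (fun x => modulus (g x)).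
Proof.
move=> mRe mIm.
rewrite (_ : (fun x => _) =
  (fun x => Num.sqrt (complex.Re (g x) ^+ 2 + complex.Im (g x) ^+ 2))).
  apply: measurable_sqrt_ge0; first by move=> x; rewrite addr_ge0 ?sqr_ge0.
  by apply: measurable_funD; exact: measurable_funX.
by apply/funext => x; rewrite /modulus; case: (g x).
Qed.

(** Over a null space an essential supremum of nonnegative functions is -oo:
    positivity of the total mass keeps the tails for p' = oo nonnegative. *)
Lemma lebesgue_tuple_setT_gt0 : (0 < lebesgue_tuple d [set: d.-tuple R])%E.
Proof.
have cube := @lebesgue_tuple_box R d (fun=> 0) (fun=> 1) (fun=> ler01).
have vol1 : \prod_(i < d) (1 - 0) = 1 :> R by rewrite big1// => i _; rewrite subr0.
rewrite vol1 in cube.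
rewrite (@lt_le_trans _ _ 1%E)// -cube.
apply: le_measure; rewrite ?inE//.
rewrite (_ : [set x | _] = \bigcap_(i in [set: 'I_d])
    (fun x : d.-tuple R => tnth x i) @^-1` `[0, 1]).
  apply: fin_bigcap_measurable => // i _; rewrite -[X in measurable X]setTI.
  exact: measurable_tnth.
by apply/seteqP; split => x /= cx i //=; exact: cx.
Qed.

End euclidean.

Section tail_recursions.
Context {R : realType} {d : nat}.
Set Implicit Arguments.
Unset Strict Implicit.
Variable g : d.-tuple R -> R[i].

(** Dropping the truncation leaves the q-th power of the norm of g; a bound that
    does not depend on t is what starts the induction over scales. *)
Lemma modified_tail_pow_bounded (q m : R) : 0 < q -> in_Lp q%:E g ->
  exists2 K : R, 0 < K & forall t : R,
    (\int[lebesgue_tuple d]_x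
       (truncation (m * q) (euclidean_norm x / t) * modulus (g x) `^ q)%:E
     <= K%:E)%E.
Proof.
move=> q_gt0 [mRe mIm]; rewrite /finite_norm unlock.
have mf := measurable_modulus mRe mIm.
under eq_integral.
  move=> x _; rewrite /= ger0_norm ?modulus_ge0//.
  over.
move=> /lty_poweRy.
rewrite invr_eq0 gt_eqF// => /(_ isT).
set I := (\int[_]_x _)%E => I_lty.
have I_ge0 : (0 <= I)%E.
  by apply: integral_ge0 => x _; rewrite lee_fin powR_ge0.
have If : I \is a fin_num by rewrite ge0_fin_numE.
(* The 1 keeps the bound positive when g = 0 almost everywhere. *)
exists (1 + fine I); first by rewrite ltr_pwDl ?fine_ge0.
move=> t; apply: (@le_trans _ _ I); last first.
  by rewrite EFinD fineK// leeDr.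
apply: ge0_le_integral => //.
- by move=> x _; rewrite lee_fin mulr_ge0 ?truncation_ge0 ?powR_ge0.
- apply/measurable_EFinP; apply: measurable_funM.
    exact: (@measurable_truncated _ _ _ (@euclidean_norm R d) measurable_euclidean_norm).
  exact: (measurableT_comp (measurable_powR _)).
- apply/measurable_EFinP.
  exact: (measurableT_comp (measurable_powR _)).
- by move=> x _; rewrite lee_fin ler_piMl ?powR_ge0 ?truncation_le1.
Qed.

Lemma modified_tail_pow_dilation (q m l t : R) : 0 < q -> 0 < m ->
  in_Lp q%:E g -> 1 <= l -> 0 < t ->
  (\int[lebesgue_tuple d]_x
     (truncation (m * q) (euclidean_norm x / (l * t)) * modulus (g x) `^ q)%:E
   <= (l `^ (- (m * q)))%:E *
      \int[lebesgue_tuple d]_x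
        (truncation (m * q) (euclidean_norm x / t) * modulus (g x) `^ q)%:E +
      \int[lebesgue_tuple d]_(x in [set x | (t <= euclidean_norm x)%R])
        (modulus (g x) `^ q)%:E)%E.
Proof.
move=> q_gt0 m_gt0 [mRe mIm _] l_ge1 t_gt0.
apply: integral_truncation_dilation => //.
- exact: euclidean_norm_ge0.
- by move=> x; exact: powR_ge0.
- exact: measurable_euclidean_norm.
- apply: (measurableT_comp (measurable_powR _)).
  exact: measurable_modulus.
- by rewrite mulr_ge0 ?ltW.
Qed.

Lemma modified_tail_sup_bounded (m : R) : in_Lp +oo g ->
  exists2 K : R, 0 < K & forall t : R, (modified_tail +oo m g t <= K%:E)%E.
Proof.
move=> [_ _]; rewrite /finite_norm unlock lebesgue_tuple_setT_gt0 => gfin.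
have [K gK] := ess_supr_bounded (f := fun x => `|modulus (g x)|) gfin.
exists (Num.max 1 K); first by rewrite lt_max ltr01.
move=> t; apply/ess_supP; apply: filterS gK => x gK.
rewrite lee_fin le_max; apply/orP; right; apply: le_trans gK.
by rewrite ger0_norm ?modulus_ge0// ler_piMl ?modulus_ge0 ?truncation_le1.
Qed.

Lemma modified_tail_sup_dilation (m l t : R) : 0 < m -> 1 <= l -> 0 < t ->
  (modified_tail +oo m g (l * t) <=
   Order.max ((l `^ (- m))%:E * modified_tail +oo m g t) (tail +oo g t))%E.
Proof.
move=> m_gt0 l_ge1 t_gt0.
apply: ess_sup_truncation_dilation => //.
- exact: euclidean_norm_ge0.
- by move=> x; exact: modulus_ge0.
- exact: ltW.
Qed.

Lemma tail_ge0 (p : \bar R) (t : R) : (0 <= tail p g t)%E.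
Proof.
case: p => [q| |] //=; first exact: poweR_ge0.
apply: ess_sup_gee; first exact: lebesgue_tuple_setT_gt0.
apply: nearW => x; rewrite patchE; case: ifP => // _.
by rewrite lee_fin modulus_ge0.
Qed.

Lemma modified_tail_sup_ge0 (m t : R) : (0 <= modified_tail +oo m g t)%E.
Proof.
apply: ess_sup_gee; first exact: lebesgue_tuple_setT_gt0.
apply: nearW => x; rewrite lee_fin mulr_ge0 ?modulus_ge0//.
exact: truncation_ge0.
Qed.

End tail_recursions.

(** * Comparison of the tails *)

Section tail_equivalence.
Context {R : realType} {d : nat}.
Variables (g : d.-tuple R -> R[i]) (m alpha : R).
Hypotheses (m_gt0 : 0 < m) (alpha_gt0 : 0 < alpha).

Let pow_tail (q t : R) :=
  (\int[lebesgue_tuple d]_(x in [set x | (t <= euclidean_norm x)%R])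
    (modulus (g x) `^ q)%:E)%E.

Let pow_modified_tail (q t : R) := (\int[lebesgue_tuple d]_x
  (truncation (m * q) (euclidean_norm x / t) * modulus (g x) `^ q)%:E)%E.

Let pow_tail_ge0 q t : (0 <= pow_tail q t)%E.
Proof. by apply: integral_ge0 => x _; rewrite lee_fin powR_ge0. Qed.

Let pow_modified_tail_ge0 q t : (0 <= pow_modified_tail q t)%E.
Proof.
apply: integral_ge0 => x _.
by rewrite lee_fin mulr_ge0 ?truncation_ge0 ?powR_ge0.
Qed.

Let rate_ge0 (c t : R) : 0 <= c -> 0 <= c * t `^ (- alpha).
Proof. by move=> c_ge0; rewrite mulr_ge0 ?powR_ge0. Qed.

Let rate_powR (c q t : R) : 0 <= c ->
  (c * t `^ (- alpha)) `^ q = c `^ q * t `^ (- (alpha * q)).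
Proof. by move=> c_ge0; rewrite powRM ?powR_ge0// -powRrM mulNr. Qed.

(** The recursion is applied to q-th powers, with exponents m q and alpha q; at
    the end the logarithm of the critical case appears to the power 1/q. *)
Lemma modified_tail_upper (q : R) : 0 < q -> in_Lp q%:E g ->
  (exists2 c2 : R, 0 < c2 &
     \forall t \near +oo, (tail q%:E g t <= (c2 * t `^ (- alpha))%:E)%E) ->
  exists2 b2 : R, 0 < b2 &
    \forall t \near +oo, (modified_tail q%:E m g t <=
      (b2 * (if (alpha < m)%R then t `^ (- alpha)
             else if alpha == m then t `^ (- alpha) * ln t `^ q^-1
             else t `^ (- m)))%:E)%E.
Proof.
move=> q_gt0 gLp [c2 c2_gt0 Fle].
have mq_ge0 : 0 <= m * q by rewrite mulr_ge0 ?ltW.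
have [K K_gt0 MK] := modified_tail_pow_bounded m q_gt0 gLp.
have Mrec t : 0 < t -> (pow_modified_tail q (2 * t)%R <=
    (2 `^ (- (m * q)))%:E * pow_modified_tail q t + pow_tail q t)%E.
  by move=> t_gt0; apply: modified_tail_pow_dilation => //; rewrite ler1n.
have {}Fle : \forall t \near +oo,
    (pow_tail q t <= (c2 `^ q * t `^ (- (alpha * q)))%:E)%E.
  apply: filterS Fle => t /=.
  rewrite (poweR_inv_le (pow_tail_ge0 q t) _ q_gt0) ?rate_ge0 ?(ltW c2_gt0)//.
  by rewrite rate_powR// ltW.
have [B B_gt0 Mle] := decay_of_additive_recursion mq_ge0 (powR_gt0 q c2_gt0)
  K_gt0 (fun t _ => MK t) Mrec Fle.
exists (B `^ q^-1); first exact: powR_gt0.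
have gt1 : \forall t \near +oo, (1 : R) < t by exact: nbhs_pinfty_gt.
apply: filterS2 gt1 Mle => t t_gt1 Mle.
have lnt_ge0 : 0 <= ln t by rewrite ln_ge0// ltW.
have q_neq0 : q != 0 by rewrite gt_eqF.
set rate := if alpha < m then _ else _.
have rate_t_ge0 : 0 <= rate.
  rewrite /rate; case: ifP => _; last case: ifP => _.
  - exact: powR_ge0.
  - by rewrite mulr_ge0 ?powR_ge0.
  - exact: powR_ge0.
rewrite [modified_tail _ _ _ _]/=
  (poweR_inv_le (pow_modified_tail_ge0 q t) _ q_gt0); last first.
  by rewrite mulr_ge0 ?powR_ge0.
apply: le_trans Mle _; rewrite lee_fin powRM ?powR_ge0//.
rewrite -(powRrM B) mulVf// powRr1 ?(ltW B_gt0)// ler_pM2l//.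
rewrite ltr_pM2r// (inj_eq (mulIf q_neq0)) /rate.
case: ifP => _; first by rewrite -powRrM mulNr.
case: eqP => [->|_]; last by rewrite -powRrM mulNr.
rewrite powRM ?powR_ge0// -!powRrM mulVf// powRr1//.
by rewrite mulNr.
Qed.

Lemma tail_lower (q : R) : 0 < q -> in_Lp q%:E g -> alpha < m ->
  (exists c1 c2 : R, [/\ 0 < c1, 0 < c2 &
     \forall t \near +oo,
       ((c1 * t `^ (- alpha))%:E <= modified_tail q%:E m g t)%E /\
       (modified_tail q%:E m g t <= (c2 * t `^ (- alpha))%:E)%E]) ->
  exists2 b1 : R, 0 < b1 &
    \forall t \near +oo, ((b1 * t `^ (- alpha))%:E <= tail q%:E g t)%E.
Proof.
move=> q_gt0 gLp am [c1 [c2 [c1_gt0 c2_gt0 Mt]]].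
have aq : alpha * q < m * q by rewrite ltr_pM2r.
have Mrec l t : 1 <= l -> 0 < t -> (pow_modified_tail q (l * t)%R <=
    (l `^ (- (m * q)))%:E * pow_modified_tail q t + pow_tail q t)%E.
  by move=> l_ge1 t_gt0; exact: modified_tail_pow_dilation.
have {}Mt : \forall t \near +oo,
    ((c1 `^ q * t `^ (- (alpha * q)))%:E <= pow_modified_tail q t)%E /\
    (pow_modified_tail q t <= (c2 `^ q * t `^ (- (alpha * q)))%:E)%E.
  apply: filterS Mt => t [] /=.
  rewrite (poweR_inv_le (pow_modified_tail_ge0 q t) _ q_gt0) ?rate_ge0 ?(ltW c2_gt0)//.
  rewrite (poweR_inv_ge (pow_modified_tail_ge0 q t) _ q_gt0) ?rate_ge0 ?(ltW c1_gt0)//.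
  by rewrite !rate_powR ?(ltW c1_gt0) ?(ltW c2_gt0).
have [b b_gt0 Fge] := lower_bound_of_recursion aq (powR_gt0 q c1_gt0)
  (powR_gt0 q c2_gt0) Mrec Mt.
exists (b `^ q^-1); first exact: powR_gt0.
apply: filterS Fge => t Fge /=.
rewrite (poweR_inv_ge (pow_tail_ge0 q t) _ q_gt0) ?rate_ge0 ?powR_ge0//.
by rewrite rate_powR ?powR_ge0// -powRrM mulVf ?(gt_eqF q_gt0)// powRr1 // ltW.
Qed.

(** A true tail decaying faster than t^-m is of no more use than one of order
    t^-m: both regimes are that of the exponent min(alpha, m). *)
Lemma modified_tail_sup_upper : in_Lp +oo g ->
  (exists2 c2 : R, 0 < c2 &
     \forall t \near +oo, (tail +oo g t <= (c2 * t `^ (- alpha))%:E)%E) ->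
  exists2 b2 : R, 0 < b2 &
    \forall t \near +oo, (modified_tail +oo m g t <=
      (b2 * (if (alpha < m)%R then t `^ (- alpha) else t `^ (- m)))%:E)%E.
Proof.
move=> gLp [c2 c2_gt0 Fle].
have [K K_gt0 MK] := modified_tail_sup_bounded m gLp.
pose b := Num.min alpha m.
have b_ge0 : 0 <= b by rewrite le_min !ltW.
have bm : b <= m by rewrite ge_min lexx orbT.
have Mrec t : 0 < t -> (modified_tail +oo m g (2 * t)%R <=
    Order.max ((2 `^ (- m))%:E * modified_tail +oo m g t) (tail +oo g t))%E.
  by move=> t_gt0; apply: modified_tail_sup_dilation; rewrite ?ler1n.
have {}Fle : \forall t \near +oo, (tail +oo g t <= (c2 * t `^ (- b))%:E)%E.
  have gt1 : \forall t \near +oo, (1 : R) < t by exact: nbhs_pinfty_gt.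
  apply: filterS2 gt1 Fle => t t_gt1 /le_trans; apply.
  by rewrite lee_fin ler_pM2l// ler_powR ?lerN2 ?ge_min ?lexx// ltW.
have [B B_gt0 Mle] :=
  decay_of_max_recursion b_ge0 bm c2_gt0 K_gt0 (fun t _ => MK t) Mrec Fle.
exists B => //; apply: filterS Mle => t; rewrite /b minElt.
by case: ifP.
Qed.

(** Here the weaker recursion with a sum suffices, so that the same lower bound
    serves all exponents. *)
Lemma tail_sup_lower : in_Lp +oo g -> alpha < m ->
  (exists c1 c2 : R, [/\ 0 < c1, 0 < c2 &
     \forall t \near +oo,
       ((c1 * t `^ (- alpha))%:E <= modified_tail +oo m g t)%E /\
       (modified_tail +oo m g t <= (c2 * t `^ (- alpha))%:E)%E]) ->
  exists2 b1 : R, 0 < b1 &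
    \forall t \near +oo, ((b1 * t `^ (- alpha))%:E <= tail +oo g t)%E.
Proof.
move=> gLp am [c1 [c2 [c1_gt0 c2_gt0 Mt]]].
apply: lower_bound_of_recursion am c1_gt0 c2_gt0 _ Mt => l t l_ge1 t_gt0.
apply: le_trans (modified_tail_sup_dilation g m_gt0 l_ge1 t_gt0) _.
rewrite ge_max leeDl ?tail_ge0// leeDr// mule_ge0 ?modified_tail_sup_ge0//.
by rewrite lee_fin powR_ge0.
Qed.

End tail_equivalence.

Theorem theorem1p4 (R : realType) (d : nat) (m alpha : R) (p : \bar R)
    (g : d.-tuple R -> R[i])
    (d_gt0 : (0 < d)%N) (m_gt0 : 0 < m) (alpha_gt0 : 0 < alpha) (p_ge1 : (1 <= p)%E)
    (gLp : in_Lp p g) :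
  (forall q : R, p = q%:E ->
    ((exists2 c2 : R, 0 < c2 &
        \forall t \near +oo, (tail p g t <= (c2 * t `^ (- alpha))%:E)%E) ->
      exists2 b2 : R, 0 < b2 &
        \forall t \near +oo, (modified_tail p m g t <=
          (b2 * (if alpha < m then t `^ (- alpha)
                 else if alpha == m then t `^ (- alpha) * ln t `^ q^-1
                 else t `^ (- m)))%:E)%E) /\
    ((exists c1 c2 : R, [/\ 0 < c1, 0 < c2 &
        \forall t \near +oo,
          ((c1 * t `^ (- alpha))%:E <= modified_tail p m g t)%E /\
          (modified_tail p m g t <= (c2 * t `^ (- alpha))%:E)%E]) ->
      exists2 b1 : R, 0 < b1 &
        \forall t \near +oo,
          ((b1 * (if alpha < m then t `^ (- alpha) else 0))%:E <= tail p g t)%E)) /\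
  (p = +oo%E ->
    ((exists2 c2 : R, 0 < c2 &
        \forall t \near +oo, (tail p g t <= (c2 * t `^ (- alpha))%:E)%E) ->
      exists2 b2 : R, 0 < b2 &
        \forall t \near +oo, (modified_tail p m g t <=
          (b2 * (if alpha < m then t `^ (- alpha) else t `^ (- m)))%:E)%E) /\
    ((exists c1 c2 : R, [/\ 0 < c1, 0 < c2 &
        \forall t \near +oo,
          ((c1 * t `^ (- alpha))%:E <= modified_tail p m g t)%E /\
          (modified_tail p m g t <= (c2 * t `^ (- alpha))%:E)%E]) ->
      exists2 b1 : R, 0 < b1 &
        \forall t \near +oo,
          ((b1 * (if alpha < m then t `^ (- alpha) else 0))%:E <= tail p g t)%E)).
Proof.
have lower_trivial : exists2 b1 : R, 0 < b1 &
    \forall t \near +oo, ((b1 * 0)%:E <= tail p g t)%E.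
  by exists 1 => //; apply: nearW => t; rewrite mulr0 tail_ge0.
split=> [q pq|poo].
  have q_gt0 : 0 < q by rewrite (lt_le_trans ltr01)// -lee_fin -pq.
  move: gLp lower_trivial; rewrite pq => gLq lower_trivial; split.
    exact: modified_tail_upper.
  by case am: (alpha < m) => //; exact: tail_lower.
move: gLp lower_trivial; rewrite poo => gLoo lower_trivial; split.
  exact: modified_tail_sup_upper.
by case am: (alpha < m) => //; exact: tail_sup_lower.
Qed.
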